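(* For each $n \ge 2$ let $p(n,\cdot)$ be a probability distribution on $\mathbb{N}=\{0,1,2,\dots\}$, let $\mathcal{H}_{n,p}$ be the harmonic ring on $n$ nodes with LRC-degree distribution $p(n,\cdot)$, and let $\mathcal{T}_{n,p}$ be its average expected greedy routing time. Let $X$ (depending on $n$) be a random variable with distribution $p(n,\cdot)$, and let $c>0$ be a constant such that $\Pr[X \le c\log n] > 0$ for all $n$. Then, as $n\to\infty$, $$\mathcal{T}_{n,p} = O\!\left(\frac{\log^2 n}{\mathbb{E}[X \mid X \le c\log n]}\right).$$
   Context: Harmonic ring. Let $V=\{0,\dots,n-1\}$, with all operations on vertices taken modulo $n$, and $E=\{(u,u+1): u\in V\}$ (the directed ring). For $u,v\in V$ the ring distance is $\delta(u,v)=v-u$ if $v\ge u$ and $\delta(u,v)=n-(u-v)$ if $v<u$ (directed distance from $u$ to $v$). To each node $u$ associate a random variable $D_u$ (its number of long-range contacts, LRCs) with $\Pr[D_u=k]=p(n,k)$, and random variables $\Delta_{u,j}\in\{1,\dots,n-1\}$, $j\ge 1$, with $\Pr[\Delta_{u,j}=r]=\frac{1}{H_{n-1}\, r}$, where $H_{n-1}=\sum_{i=1}^{n-1}1/i$. All the variables $D_u$, $\Delta_{u,j}$ ($u\in V$, $j\ge 1$) are mutually independent. Let $E_u=\{(u,u+\Delta_{u,j}): 1\le j\le D_u\}$ (edges chosen with replacement, so not necessarily distinct) and $E'=E\cup\bigcup_{u\in V}E_u$. The random directed graph $\mathcal{H}_{n,p}=(V,E')$ is the harmonic ring. Greedy routing.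 A greedy route from $u$ to $v$ is a sequence $u=s_0,s_1,\dots,s_k=v$ with $(s_j,s_{j+1})\in E'$ and such that $(s_j,w)\in E'$ implies $\delta(s_{j+1},v)\le\delta(w,v)$; it exists and is unique, and the greedy routing time from $u$ to $v$ is $k$. $T_r$ denotes the expected greedy routing time from a source to a destination at ring distance $r$ (i.e. $\delta(\text{source},\text{destination})=r$; this depends only on $r$, with $T_0=0$), and $\mathcal{T}_{n,p}=\frac1n\sum_{r=0}^{n-1}T_r$. Convention: where $\mathbb{E}[X\mid X\le c\log n]=0$, the right-hand side is read as $+\infty$ (no claim is made for such $n$). *)

(* Defs.v *)
(* MathComp / MathComp-Analysis *)
From HB Require Import structures.
From mathcomp Require Import all_boot all_order all_algebra.
From mathcomp Require Import finmap.
From mathcomp Require Import all_classical all_reals all_analysis.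
From mathcomp Require Import zify.

Set Implicit Arguments.
Unset Strict Implicit.
Unset Printing Implicit Defensive.

Import Order.TTheory GRing.Theory Num.Theory.
Import numFieldNormedType.Exports.

Local Open Scope classical_set_scope.
Local Open Scope ring_scope.

(* Product rule over every finite subfamily. *)
Definition mutually_independent {R : realType} {d d' : measure_display}
    {Omega : measurableType d} {S : measurableType d'}
    (P : probability Omega R) {I : choiceType} (X : I -> {RV P >-> S}) : Prop :=
  forall (J : {fset I}) (B : I -> set S), (forall i, measurable (B i)) ->
    P [set w | forall i, i \in J -> B i (X i w)] =
    (\prod_(i <- J) P [set w | B i (X i w)])%E.

(* Conditioning on an event of positive probability.  The value is in \bar R,
   where 0^-1 = +oo: for a > 0, a / cond_expectation P X A is +oo whenever the
   conditional expectation vanishes. *)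
Definition cond_expectation {R : realType} {d : measure_display}
    {Omega : measurableType d} (P : probability Omega R)
    (X : Omega -> R) (A : set Omega) : \bar R :=
  ((\int[P]_(w in A) (X w)%:E) / P A)%E.

Section Ring.
Variable n : nat.
Implicit Types (u v w : 'I_n) (e : rel 'I_n) (s : seq 'I_n).

Definition ring_dist u v : nat := if (u <= v)%N then (v - u)%N else (n - (u - v))%N.

(* k u is the number of long-range contacts of u.  The offsets are numbered
   from 0: Delta u j is the (j+1)-st one. *)
Definition ring_edge (k : 'I_n -> nat) (Delta : 'I_n -> nat -> nat) : rel 'I_n :=
  fun u w => (w == u.+1 %% n :> nat)%N ||
             [exists j : 'I_(k u), w == (u + Delta u j) %% n :> nat]%N.

Definition greedy_step e v : rel 'I_n :=
  fun x y => e x y && [forall w, e x w ==> (ring_dist y v <= ring_dist w v)%N].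

(* The route is u :: s, so that its number of steps is size s; it stops at its
   first visit to v (otherwise it could leave v and come back around the ring,
   and would not be unique). *)
Definition greedy_route e u v s : Prop :=
  [/\ path (greedy_step e v) u s, last u s = v & v \notin belast u s].

(* The length of the greedy route; see greedy_route_ex and greedy_route_uniq
   for its existence and uniqueness. *)
Definition greedy_time e u v : nat :=
  xget 0%N [set k | exists2 s, greedy_route e u v s & size s = k].

Lemma ring_dist_inj v : injective (ring_dist^~ v).
Proof.
move=> x y; rewrite /ring_dist => h; apply/val_inj => /=.
have := ltn_ord x; have := ltn_ord y; have := ltn_ord v.
by move: h; case: ifP; case: ifP; lia.
Qed.

Lemma greedy_step_uniq e v x y z :
  greedy_step e v x y -> greedy_step e v x z -> y = z.
Proof.
move=> /andP[xy /forallP hy] /andP[xz /forallP hz].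
apply: (@ring_dist_inj v); apply/eqP; rewrite eqn_leq.
by rewrite (implyP (hy z) xz) (implyP (hz y) xy).
Qed.

Lemma greedy_route_uniq e u v s t :
  greedy_route e u v s -> greedy_route e u v t -> s = t.
Proof.
move=> [].
elim: s u t => [|x s IHs] u [|y t] //=.
- by move=> _ -> _ [_ _]; rewrite /= inE eqxx /=.
- by move=> _ _ h [_ uv _]; move: h; rewrite -uv inE eqxx /=.
move=> /andP[ux ps] ls; rewrite inE negb_or => /andP[_ ns].
move=> [] /= /andP[uy pt] lt; rewrite inE negb_or => /andP[_ nt].
move: pt lt nt; rewrite -(greedy_step_uniq ux uy) => pt lt nt.
by rewrite (IHs x t ps ls ns).
Qed.

Lemma greedy_route_ex k Delta u v :
  exists s, greedy_route (ring_edge k Delta) u v s.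
Proof.
set e := ring_edge k Delta.
have [m] := ubnP (ring_dist u v); elim: m u => // m IHm u hm.
have [->|uv] := eqVneq u v; first by exists [::].
have n0 : (0 < n)%N by apply: leq_ltn_trans (ltn_ord u).
pose u1 : 'I_n := Ordinal (ltn_pmod u.+1 n0).
have eu1 : e u u1 by rewrite /e /ring_edge /= eqxx.
have du1 : (ring_dist u1 v < ring_dist u v)%N.
  have uv' : (val u != val v) by [].
  have := ltn_ord u; have := ltn_ord v; rewrite /ring_dist /=.
  move: uv' => /eqP /= uv' hv; rewrite leq_eqVlt => /orP[/eqP hu|hu].
    rewrite hu modnn leq0n; case: ifP; lia.
  by rewrite modn_small//; case: ifP; case: ifP; lia.
have [y ey ymin] := arg_minnP (fun w => ring_dist w v) eu1.
have [|s [ps ls ns]] := IHm y.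
  by have := ymin _ eu1; lia.
exists (y :: s); split => //=.
  by rewrite /greedy_step ey ps andbT; apply/forallP => w; apply/implyP/ymin.
by rewrite inE negb_or eq_sym uv.
Qed.

End Ring.

Section HarmonicRing.
Context {R : realType} {d : measure_display} {Omega : measurableType d}.
Variables (n : nat) (P : probability Omega R).
Variables (D : 'I_n -> {RV P >-> nat}) (Delta : 'I_n -> nat -> {RV P >-> nat}).

Definition ring_variables (i : 'I_n + 'I_n * nat) : {RV P >-> nat} :=
  match i with inl u => D u | inr (u, j) => Delta u j end.

Record harmonic_ring (p : probability nat R) : Prop := HarmonicRing {
  lrc_number_law : forall u k, P [set w | D u w = k] = p [set k] ;
  lrc_offset_range : forall u j w, (1 <= Delta u j w <= n.-1)%N ;
  lrc_offset_law : forall u j r, (1 <= r <= n.-1)%N ->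
    P [set w | Delta u j w = r] =
    (((\sum_(1 <= i < n) i%:R^-1) * r%:R)^-1)%:E ;
  lrc_independent : mutually_independent ring_variables }.

Definition random_edge (w : Omega) : rel 'I_n :=
  ring_edge (fun u => D u w) (fun u j => Delta u j w).

Definition expected_greedy_time (u v : 'I_n) : \bar R :=
  'E_P[fun w => (greedy_time (random_edge w) u v)%:R]%E.

(* T_r: in a harmonic ring the expectation is the same for all pairs (u, v) at
   ring distance r, and T_r is this common value. *)
Definition expected_time_at (r : nat) : \bar R :=
  xget 0%E [set t | exists u v, ring_dist u v = r /\ t = expected_greedy_time u v].

Definition average_greedy_time : \bar R :=
  ((n%:R^-1)%:E * \sum_(0 <= r < n) expected_time_at r)%E.

End HarmonicRing.

(* Main.v *)
(** Greedy routing never meets a node twice, so the contact lists met along a route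
    are fresh: for u <> v, the first step of the route from u depends on the contact
    list of u only, and the remaining routing time on those of the other nodes.  At
    distance r, each contact falls in [r/2, r] with probability at least 1/(2H), where
    H = H_(n-1), and then the distance to the destination is halved.  Since a large
    number of contacts can only help, it may be truncated at M = floor(c log n), and
    Bernoulli's inequality shows that the distance is halved with probability at
    least q = E[X | X <= M] / (2H(1 + c/2)).  There are at most 1 + log_2 n halvings,
    each taking expected time at most 1/q, and H is of order log n. *)

Require Import Defs.
From HB Require Import structures.
From mathcomp Require Import all_boot all_order all_algebra.
From mathcomp Require Import finmap.
From mathcomp Require Import all_classical all_reals all_analysis.
From mathcomp Require Import measurable_realfun zify ring lra.

Set Implicit Arguments.
Unset Strict Implicit.
Unset Printing Implicit Defensive.

Import Order.TTheory GRing.Theory Num.Theory.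
Import numFieldNormedType.Exports.

Local Open Scope classical_set_scope.
Local Open Scope ring_scope.

(** * Independence of countably valued maps *)

(** Duplicate-free lists replace finite sets in the product rule, because lists can be concatenated
    and split. *)
Lemma mutually_independent_seq {R : realType} {d d' : measure_display}
    {Omega : measurableType d} {S : measurableType d'}
    (P : probability Omega R) {I : choiceType} (X : I -> {RV P >-> S})
    (B : I -> set S) (s : seq I) :
    mutually_independent X -> (forall i, measurable (B i)) -> uniq s ->
  P [set w | forall i, i \in s -> B i (X i w)] =
  (\prod_(i <- s) P [set w | B i (X i w)])%E.
Proof.
move=> indX mB us.
have := indX (seq_fset tt s) B mB.
rewrite (perm_big s) => [<-|]; last first.
  by rewrite -[X in perm_eq _ X]undup_id// seq_fset_perm.
by congr (P _); apply/seteqP; split => w /= h i is_; apply: h; move: is_; rewrite (seq_fsetE tt s).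
Qed.

Lemma mutually_independent_cat {R : realType} {d d' : measure_display}
    {Omega : measurableType d} {S : measurableType d'}
    (P : probability Omega R) {I : choiceType} (X : I -> {RV P >-> S})
    (B : I -> set S) (s t : seq I) :
    mutually_independent X -> (forall i, measurable (B i)) -> uniq (s ++ t) ->
  P [set w | forall i, i \in s ++ t -> B i (X i w)] =
  (P [set w | forall i, i \in s -> B i (X i w)] *
   P [set w | forall i, i \in t -> B i (X i w)])%E.
Proof.
move=> indX mB ust.
have /and3P[us _ ut] : [&& uniq s, ~~ has (mem s) t & uniq t] by rewrite -cat_uniq.
by rewrite !mutually_independent_seq// big_cat.
Qed.

Section CountableMaps.
Context {d : measure_display} {T : measurableType d} {K : countType}.
Variable L : T -> K.
Hypothesis mL : forall a, measurable [set w | L w = a].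

Lemma measurable_countable_preimage (A : set K) : measurable [set w | A (L w)].
Proof.
have -> : [set w | A (L w)] = \bigcup_a ([set w | L w = a] `&` [set _ | A a]).
  apply/seteqP; split => w /=; first by move=> Aw; exists (L w).
  by move=> [a _ [/= ->]].
apply: countable_bigcupT_measurable; first exact: countableP.
move=> a; have [Aa|nAa] := pselect (A a).
- by rewrite (_ : [set _ | A a] = setT) ?setIT//; apply/seteqP; split.
- by rewrite (_ : [set _ | A a] = set0) ?setI0//; apply/seteqP; split.
Qed.

(** By countable additivity, independence of [F] from each single value of [L] extends to every set
    of values. *)
Lemma countable_independent {R : realType} (P : probability T R)
    (F : set T) (A : set K) :
    measurable F ->
    (forall a, P ([set w | L w = a] `&` F) = (P [set w | L w = a] * P F)%E) ->
  P ([set w | A (L w)] `&` F) = (P [set w | A (L w)] * P F)%E.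
Proof.
move=> mF indF.
(* [pickle] numbers the fibres of [L] by natural numbers, as countable additivity requires. Since it
   is injective, each [G k] is a whole fibre or empty. *)
pose G (k : nat) : set T := [set w | A (L w) /\ choice.pickle (L w) = k].
have mG k : measurable (G k).
  exact: (measurable_countable_preimage (fun a => A a /\ choice.pickle a = k)).
have AE : [set w : T | A (L w)] = \bigcup_k G k.
  apply/seteqP; split => w /=; first by move=> Aw; exists (choice.pickle (L w)).
  by move=> [k _ [? _]].
have GF k : P (G k `&` F) = (P F * P (G k))%E.
  have [[w [Aw kw]]|/asboolPn/forallp_asboolPn G0] := pselect (exists w, G k w).
    have -> : G k = [set w' | L w' = L w].
      apply/seteqP; split => w' /=; rewrite /G /=.
        by move=> [_ kw']; apply: (pcan_inj choice.pickleK); rewrite kw.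
      by move=> ->.
    by rewrite indF muleC.
  have -> : G k = set0 by apply/seteqP; split => // w /G0.
  by rewrite set0I measure0 mule0.
rewrite AE setI_bigcupl !measure_bigcup//.
- rewrite (eq_eseriesr (fun k _ => GF k)).
  by rewrite -(@fineK _ (P F)) ?fin_num_measure// nneseriesZl// muleC.
- by move=> i j _ _ [w [[_ <-] [_ <-]]].
- by move=> k _; exact: measurableI.
- by move=> i j _ _ [w [[[_ <-] _] [[_ <-] _]]].
Qed.

End CountableMaps.

(** * Deterministic greedy routing *)

Section ContactLists.
Variable n : nat.
Implicit Types (u v w x y z : 'I_n) (e : rel 'I_n) (s : seq 'I_n)
  (c : 'I_n -> seq nat).

(** A finite list retains exactly the offsets that produce edges. Unlike an infinite sequence of
    offsets, it ranges over a countable type. *)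
Definition contact_edge c : rel 'I_n :=
  ring_edge (fun u => size (c u)) (fun u j => nth 0%N (c u) j).

Lemma ring_edge_contact (k : 'I_n -> nat) (Delta : 'I_n -> nat -> nat) :
  ring_edge k Delta = contact_edge (fun u => mkseq (Delta u) (k u)).
Proof.
apply/funext => u; apply/funext => w; rewrite /contact_edge /ring_edge.
congr (_ || _); apply/existsP/existsP => -[[j jk] /= /eqP jw].
- have jk' : (j < size (mkseq (Delta u) (k u)))%N by rewrite size_mkseq.
  by exists (Ordinal jk'); rewrite /= nth_mkseq// jw.
- have jk' : (j < k u)%N by move: jk; rewrite size_mkseq.
  by exists (Ordinal jk'); rewrite /= jw nth_mkseq.
Qed.

Lemma eq_contact_edge c c' u : c u = c' u -> contact_edge c u =1 contact_edge c' u.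
Proof. by move=> cc' w; rewrite /contact_edge /ring_edge cc'. Qed.

Lemma eq_greedy_step e e' v x y :
  e x =1 e' x -> greedy_step e v x y = greedy_step e' v x y.
Proof.
move=> ee'; rewrite /greedy_step ee'; congr (_ && _).
by apply: eq_forallb => w; rewrite ee'.
Qed.

Lemma ring_dist_lt u v : (ring_dist u v < n)%N.
Proof.
rewrite /ring_dist; have := ltn_ord u; have := ltn_ord v.
by case: ifP; lia.
Qed.

Lemma ring_dist_eq0 u v : (ring_dist u v == 0%N) = (u == v).
Proof.
rewrite /ring_dist -val_eqE /=; have := ltn_ord u; have := ltn_ord v.
by case: ifP; lia.
Qed.

(** A jump of at most the remaining distance does not overshoot [v]; the two cases are whether or
    not it passes the origin of the ring. *)
Lemma ring_distD u v w (r : nat) : (w = (u + r) %% n :> nat)%N ->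
  (r <= ring_dist u v)%N -> ring_dist w v = (ring_dist u v - r)%N.
Proof.
move=> wr rle; have rn := leq_ltn_trans rle (ring_dist_lt u v).
have [un|un] := ltnP (u + r)%N n.
  move: wr rle; rewrite modn_small// /ring_dist => ->.
  by have := ltn_ord v; case: ifP; case: ifP; lia.
have {}wr : (w = u + r - n :> nat)%N.
  by rewrite wr -{1}(subnK un) modnDr modn_small//; have := ltn_ord u; lia.
move: rle; rewrite /ring_dist wr.
by have := ltn_ord v; have := ltn_ord u; case: ifP; case: ifP; lia.
Qed.

Lemma greedy_timeE e u v s : greedy_route e u v s -> greedy_time e u v = size s.
Proof.
move=> us; apply: xget_unique; first by exists s.
by move=> k [t ut <-]; rewrite (greedy_route_uniq us ut).
Qed.

Lemma greedy_time_refl e v : greedy_time e v v = 0%N.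
Proof. by rewrite (@greedy_timeE _ _ _ [::]). Qed.

Lemma greedy_step_ex c u v : u != v -> exists y, greedy_step (contact_edge c) v u y.
Proof.
move=> uv; have [[|y s] [/= pus lus _]] :=
  greedy_route_ex (fun x => size (c x)) (fun x j => nth 0%N (c x) j) u v.
- by rewrite lus eqxx in uv.
- by exists y; case/andP: pus.
Qed.

Lemma greedy_time_step c u v y : u != v -> greedy_step (contact_edge c) v u y ->
  greedy_time (contact_edge c) u v = (greedy_time (contact_edge c) y v).+1.
Proof.
move=> uv uy; have [s ys] :=
  greedy_route_ex (fun x => size (c x)) (fun x j => nth 0%N (c x) j) y v.
rewrite (greedy_timeE ys); apply: (@greedy_timeE _ _ _ (y :: s)).
case: ys => pys lys nys; split => //=; first by rewrite uy.
by rewrite inE negb_or eq_sym uv.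
Qed.

(** The greedy choice is at least as good as the neighbour reached by the contact [r]. *)
Lemma greedy_step_contact c u v y (r : nat) : r \in c u ->
  (r <= ring_dist u v)%N -> greedy_step (contact_edge c) v u y ->
  (ring_dist y v <= ring_dist u v - r)%N.
Proof.
move=> rcu rle /andP[_ /forallP ymin].
have n0 : (0 < n)%N by apply: leq_ltn_trans (ltn_ord u).
pose w := Ordinal (ltn_pmod (u + r)%N n0).
rewrite -(@ring_distD u v w r)//; apply: (implyP (ymin w)).
have jlt : (index r (c u) < size (c u))%N by rewrite index_mem.
by apply/orP; right; apply/existsP; exists (Ordinal jlt); rewrite /= nth_index.
Qed.

(** The ring edge to the successor of [u] is always available and gains 1. *)
Lemma greedy_step_lt c u v y : u != v -> greedy_step (contact_edge c) v u y ->
  (ring_dist y v < ring_dist u v)%N.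
Proof.
move=> uv /andP[_ /forallP ymin].
have n0 : (0 < n)%N by apply: leq_ltn_trans (ltn_ord u).
have d0 : (0 < ring_dist u v)%N by rewrite lt0n ring_dist_eq0.
pose w := Ordinal (ltn_pmod (u + 1)%N n0).
apply: (@leq_ltn_trans (ring_dist u v - 1)); last by rewrite subn1 prednK.
rewrite -(@ring_distD u v w 1)//; apply: (implyP (ymin w)).
by apply/orP; left; rewrite /= addn1.
Qed.

Lemma greedy_time_le c u v :
  (greedy_time (contact_edge c) u v <= ring_dist u v)%N.
Proof.
have [m] := ubnP (ring_dist u v); elim: m u => // m IHm u um.
have [->|uv] := eqVneq u v; first by rewrite greedy_time_refl.
have [y uy] := greedy_step_ex c uv; have yu := greedy_step_lt uv uy.
by rewrite (greedy_time_step uv uy) (leq_ltn_trans _ yu)// IHm//; lia.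
Qed.

(** The distance to [v] decreases along the route, so only contact lists of nodes no farther from
    [v] than [u] are ever read. This is the source of the independence used later. *)
Lemma eq_greedy_time c c' u v :
    (forall x, (ring_dist x v <= ring_dist u v)%N -> c x = c' x) ->
  greedy_time (contact_edge c) u v = greedy_time (contact_edge c') u v.
Proof.
have [m] := ubnP (ring_dist u v); elim: m u => // m IHm u um cc'.
have [->|uv] := eqVneq u v; first by rewrite !greedy_time_refl.
have [y uy] := greedy_step_ex c uv; have yu := greedy_step_lt uv uy.
rewrite (greedy_time_step uv uy) (@greedy_time_step c' _ _ y)//; last first.
  by rewrite -(eq_greedy_step (e := contact_edge c))//; apply: eq_contact_edge; exact: cc'.
congr _.+1; apply: IHm => [|x xy]; first by lia.
by apply: cc'; lia.
Qed.

End ContactLists.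

(** * Independence of contact lists *)

Section Configuration.
Context {R : realType} {d : measure_display} {Omega : measurableType d}.
Variables (n : nat) (P : probability Omega R).
Variables (D : 'I_n -> {RV P >-> nat}) (Delta : 'I_n -> nat -> {RV P >-> nat}).
Implicit Types (u v y z : 'I_n) (w : Omega) (c : {ffun 'I_n -> seq nat})
  (U W : {set 'I_n}) (s : seq 'I_n).

Let X := ring_variables D Delta.

Definition contacts w : 'I_n -> seq nat :=
  fun u => mkseq (fun j => Delta u j w) (D u w).

(** The part of the random graph carried by [U]: lists outside [U] are erased. The values form a
    countable type, so events reduce to single configurations. *)
Definition config U w : {ffun 'I_n -> seq nat} :=
  [ffun u => if u \in U then contacts w u else [::]].

Lemma random_edge_contact w : random_edge D Delta w = contact_edge (contacts w).
Proof. exact: ring_edge_contact. Qed.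

(* The contact lists of the nodes in s are those given by c if and only if the
   finitely many variables read_vars c s take the values read_val c. *)
Definition read_vars c s : seq ('I_n + 'I_n * nat) :=
  flatten [seq inl u :: [seq inr (u, j) | j <- iota 0 (size (c u))] | u <- s].

Definition read_val c (i : 'I_n + 'I_n * nat) : nat :=
  match i with inl u => size (c u) | inr (u, j) => nth 0%N (c u) j end.

Lemma read_vars_uniq c s : uniq s -> uniq (read_vars c s).
Proof.
(* Every variable belongs to one node, so the blocks read for distinct nodes are disjoint. *)
pose owner (i : 'I_n + 'I_n * nat) := match i with inl u => u | inr (u, _) => u end.
have ownerP s' i : i \in read_vars c s' -> owner i \in s'.
  move=> /flatten_mapP[u us']; rewrite inE => /orP[/eqP ->//|].
  by move=> /mapP[j _ ->].
elim: s => // u s IHs /andP[us us'].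
have -> : read_vars c (u :: s) =
  (inl u :: [seq inr (u, j) | j <- iota 0 (size (c u))]) ++ read_vars c s by [].
rewrite cat_uniq IHs// andbT /= map_inj_uniq ?iota_uniq ?andbT; last by move=> i j [].
apply/andP; split; first by apply/mapP => -[].
apply/hasPn => i /ownerP; apply: contraL.
by rewrite inE => /orP[/eqP ->//|/mapP[j _ ->]].
Qed.

Lemma read_varsP c s w :
  (forall i, i \in read_vars c s -> X i w = read_val c i) <->
  {in s, contacts w =1 c}.
Proof.
split=> [h u us|h i /flatten_mapP[u us]]; last first.
  rewrite inE => /orP[/eqP ->|/mapP[j]] /=.
    by rewrite -(h u us) size_mkseq.
  rewrite mem_iota /= => jc -> /=; rewrite -(h u us) nth_mkseq//.
  by move: jc; rewrite -(h u us) size_mkseq.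
(* The length comes first: it decides which offsets belong to the list. *)
have hD : D u w = size (c u) :> nat.
  by apply: (h (inl u)); apply/flatten_mapP; exists u; rewrite ?inE ?eqxx.
apply: (@eq_from_nth _ 0%N); first by rewrite size_mkseq hD.
move=> j; rewrite size_mkseq => jD; rewrite nth_mkseq//.
apply: (h (inr (u, j))); apply/flatten_mapP; exists u => //.
by rewrite inE /= map_f// mem_iota /= -hD.
Qed.

Lemma config_fibre U w c : {in ~: U, forall u, c u = [::]} ->
  config U w = c <-> forall i, i \in read_vars c (enum U) -> X i w = read_val c i.
Proof.
move=> cU; rewrite read_varsP; split.
  by move=> <- u; rewrite mem_enum ffunE => ->.
move=> h; apply/ffunP => u; rewrite ffunE; case: ifPn => uU.
  by rewrite h// mem_enum.
by rewrite cU// inE.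
Qed.

Lemma config_out U w u : u \notin U -> config U w u = [::].
Proof. by rewrite ffunE => /negbTE ->. Qed.

Lemma measurable_variable i (B : set nat) : measurable [set w | B (X i w)].
Proof. by rewrite -[[set w | _]]setTI; apply: measurable_funPT. Qed.

Lemma measurable_variables (B : 'I_n + 'I_n * nat -> set nat)
    (s : seq ('I_n + 'I_n * nat)) :
  measurable [set w | forall i, i \in s -> B i (X i w)].
Proof.
elim: s => [|i s IHs].
  by rewrite (_ : [set w | _] = setT)//; apply/seteqP; split.
rewrite (_ : [set w | _] = [set w | B i (X i w)] `&`
    [set w | forall i, i \in s -> B i (X i w)]).
  by apply: measurableI => //; exact: measurable_variable.
apply/seteqP; split => w /=.
  by move=> h; split => [|j js]; apply: h; rewrite inE ?eqxx// js orbT.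
by move=> [hi hs] j; rewrite inE => /orP[/eqP ->//|/hs].
Qed.

Lemma measurable_config_fibre U c : measurable [set w | config U w = c].
Proof.
have [cU|ncU] := pselect {in ~: U, forall u, c u = [::]}.
  rewrite (_ : [set w | _] = [set w | forall i, i \in read_vars c (enum U) ->
      X i w = read_val c i]).
    exact: (measurable_variables (fun i => [set read_val c i])).
  by apply/seteqP; split => w /(config_fibre _ cU).
rewrite (_ : [set w | _] = set0)//; apply/seteqP; split => // w /= h.
by apply: ncU => u; rewrite inE -h => /config_out.
Qed.

Lemma measurable_config U (A : set {ffun 'I_n -> seq nat}) :
  measurable [set w | A (config U w)].
Proof. by apply: measurable_countable_preimage; exact: measurable_config_fibre. Qed.

Hypothesis indX : mutually_independent X.

(** Each fibre fixes finitely many variables, and disjoint node sets read disjoint sets of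
    variables; the product rule then applies to the concatenated list. *)
Lemma config_fibre_independent U W c c' : {in U, forall u, u \notin W} ->
  P ([set w | config U w = c] `&` [set w | config W w = c']) =
  (P [set w | config U w = c] * P [set w | config W w = c'])%E.
Proof.
move=> UW.
have [cU|ncU] := pselect {in ~: U, forall u, c u = [::]}; last first.
  rewrite (_ : [set w | config U w = c] = set0) ?set0I ?measure0 ?mul0e//.
  apply/seteqP; split => // w /= h; apply: ncU => u.
  by rewrite inE -h => /config_out.
have [cW|ncW] := pselect {in ~: W, forall u, c' u = [::]}; last first.
  rewrite (_ : [set w | config W w = c'] = set0) ?setI0 ?measure0 ?mule0//.
  apply/seteqP; split => // w /= h; apply: ncW => u.
  by rewrite inE -h => /config_out.
(* Gluing [c] and [c'] expresses both fibres through one family of prescribed values. *)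
pose b := [ffun u => if u \in U then c u else c' u].
have fibreE V (g : {ffun 'I_n -> seq nat}) : {in ~: V, forall u, g u = [::]} ->
    {in V, g =1 b} -> [set w | config V w = g] =
    [set w | forall i, i \in read_vars b (enum V) -> X i w = read_val b i].
  move=> gV gb; apply/seteqP; split => w /=.
    by move=> /(config_fibre _ gV)/read_varsP h; apply/read_varsP => u uV;
      rewrite h// gb// -mem_enum.
  by move=> /read_varsP h; apply/(config_fibre _ gV)/read_varsP => u uV;
    rewrite h// gb// -mem_enum.
rewrite (fibreE U) ?(fibreE W)//; last 2 first.
- move=> u uW; rewrite ffunE; case: ifPn => // uU.
  by have := UW u uU; rewrite uW.
- by move=> u uU; rewrite ffunE uU.
rewrite -(@mutually_independent_cat _ _ _ _ _ _ _ X (fun i => [set read_val b i]))//.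
- rewrite (_ : _ `&` _ = [set w | forall i,
    i \in read_vars b (enum U) ++ read_vars b (enum W) -> X i w = read_val b i])//.
  apply/seteqP; split => w /=.
    by move=> [hU hW] i; rewrite mem_cat => /orP[/hU|/hW].
  by move=> h; split => i iV; apply: h; rewrite mem_cat iV ?orbT.
- rewrite /read_vars -flatten_cat -map_cat; apply: read_vars_uniq.
  rewrite cat_uniq !enum_uniq andbT /=; apply/hasPn => u.
  by rewrite /= !mem_enum; apply: contraL => /UW.
Qed.

(** The passage from single values to sets of values is made twice, once for each configuration. *)
Lemma config_independent U W (A C : set {ffun 'I_n -> seq nat}) :
    {in U, forall u, u \notin W} ->
  P ([set w | A (config U w)] `&` [set w | C (config W w)]) =
  (P [set w | A (config U w)] * P [set w | C (config W w)])%E.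
Proof.
move=> UW; apply: countable_independent.
- exact: measurable_config_fibre.
- exact: measurable_config.
move=> c; rewrite setIC muleC; apply: countable_independent.
- exact: measurable_config_fibre.
- exact: measurable_config_fibre.
by move=> c'; rewrite setIC muleC config_fibre_independent.
Qed.

End Configuration.

(** * One step of the route *)

Lemma measure_fin_pred {d : measure_display} {T : measurableType d} {R : realType}
    (mu : {measure set T -> \bar R}) (K : finType) (Q : pred K) (F : K -> set T) :
    (forall y, measurable (F y)) -> (forall y z w, F y w -> F z w -> y = z) ->
  mu (\bigcup_(y in [set` Q]) F y) = (\sum_(y | Q y) mu (F y))%E.
Proof.
move=> mF injF; rewrite measure_fin_bigcup//; last first.
  by move=> y z _ _ [w [wy wz]]; exact: injF wy wz.
rewrite (_ : [set` Q] = [set` enum Q]).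
  by rewrite -fsbig_seq ?enum_uniq// big_enum.
by apply/seteqP; split => y /=; rewrite mem_enum.
Qed.

Section Routing.
Context {R : realType} {d : measure_display} {Omega : measurableType d}.
Variables (n : nat) (P : probability Omega R).
Variables (D : 'I_n -> {RV P >-> nat}) (Delta : 'I_n -> nat -> {RV P >-> nat}).
Implicit Types (u v y z : 'I_n) (w : Omega).

Local Notation route_edge := (random_edge D Delta).

Definition step_event u v y : set Omega :=
  [set w | greedy_step (route_edge w) v u y].

Definition late_event (k : nat) u v : set Omega :=
  [set w | (k < greedy_time (route_edge w) u v)%N].

Lemma step_event_config u v y : step_event u v y =
  [set w | greedy_step (contact_edge (config D Delta [set u]%SET w)) v u y].
Proof.
apply/funext => w; apply/propext; rewrite /step_event /= random_edge_contact.
rewrite (@eq_greedy_step _ _ (contact_edge (config D Delta [set u]%SET w)))//.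
by apply: eq_contact_edge; rewrite ffunE inE eqxx.
Qed.

(** [U] is left free: the whole ring gives measurability, and the ring without one node gives
    independence from the step at that node. *)
Lemma late_event_config (U : {set 'I_n}) k u v :
    (forall z, (ring_dist z v <= ring_dist u v)%N -> z \in U) ->
  late_event k u v =
  [set w | (k < greedy_time (contact_edge (config D Delta U w)) u v)%N].
Proof.
move=> hU; apply/funext => w; apply/propext; rewrite /late_event /= random_edge_contact.
by rewrite (@eq_greedy_time _ _ (config D Delta U w))// => z /hU zU; rewrite ffunE zU.
Qed.

Lemma measurable_step_event u v y : measurable (step_event u v y).
Proof.
rewrite step_event_config.
exact: (@measurable_config _ _ _ _ _ D Delta _
  [set c : {ffun 'I_n -> seq nat} | greedy_step (contact_edge c) v u y]).
Qed.

Lemma measurable_late_event k u v : measurable (late_event k u v).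
Proof.
rewrite (@late_event_config finset.setT); last by move=> z _; rewrite finset.in_setT.
exact: (@measurable_config _ _ _ _ _ D Delta _ [set c : {ffun 'I_n -> seq nat} |
  (k < greedy_time (contact_edge c) u v)%N]).
Qed.

Lemma step_event_lt u v y w : u != v -> step_event u v y w ->
  (ring_dist y v < ring_dist u v)%N.
Proof. by move=> uv; rewrite /step_event /= random_edge_contact => /greedy_step_lt ->. Qed.

Lemma step_event_uniq u v y z w :
  step_event u v y w -> step_event u v z w -> y = z.
Proof. exact: greedy_step_uniq. Qed.

Lemma step_event_ex u v w : u != v -> exists y, step_event u v y w.
Proof.
move=> uv; have [y uy] := greedy_step_ex (contacts D Delta w) uv.
by exists y; rewrite /step_event /= random_edge_contact.
Qed.

(** The tail-sum formula for the expectation; it stops at [n] because the routing time is at most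
    the ring distance. *)
Lemma expected_greedy_time_late u v :
  expected_greedy_time D Delta u v = (\sum_(k < n) P (late_event k u v))%E.
Proof.
rewrite /expected_greedy_time unlock.
transitivity (\int[P]_w (\sum_(k < n) (\1_(late_event k u v) w : R)%:E))%E.
  apply: eq_integral => w _; rewrite sumEFin; congr (_%:E).
  have : (greedy_time (route_edge w) u v <= n)%N.
    rewrite random_edge_contact (leq_trans (greedy_time_le _ _ _))//.
    exact/ltnW/ring_dist_lt.
  rewrite (eq_bigr (fun k : 'I_n =>
    ((k < greedy_time (route_edge w) u v)%N : nat)%:R)); last first.
    move=> k _; rewrite indicE; congr (_%:R); congr nat_of_bool.
    by apply/idP/idP => [/set_mem//|h]; apply/mem_set.
  move: (greedy_time _ _ _) => m mn; rewrite -natr_sum; congr (_%:R).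
  rewrite -(big_mkord predT (fun k => nat_of_bool (k < m)%N)) -big_mkcond.
  by rewrite -(big_nat_widen 0 m n predT (fun=> 1%N)) ?sum_nat_const_nat ?subn0 ?muln1.
rewrite ge0_integral_sum//; last first.
  by move=> k; apply/measurable_EFinP/measurable_indic/measurable_late_event.
apply: eq_bigr => k _; rewrite integral_indic ?setIT//.
exact: measurable_late_event.
Qed.

Hypothesis indX : mutually_independent (ring_variables D Delta).

(** The step at [u] reads the list of [u] only. From a strictly closer [y], the route never reads
    that list; for any other [y] the step event is empty. *)
Lemma step_late_independent k u v y : u != v ->
  P (step_event u v y `&` late_event k y v) =
  (P (step_event u v y) * P (late_event k y v))%E.
Proof.
move=> uv; have [yu|yu] := ltnP (ring_dist y v) (ring_dist u v); last first.
  rewrite (_ : step_event u v y = set0) ?set0I ?measure0 ?mul0e//.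
  by apply/seteqP; split => // w /(step_event_lt uv); rewrite ltnNge yu.
rewrite step_event_config (@late_event_config [set z | z != u]%SET).
  apply: (config_independent indX
    [set c : {ffun 'I_n -> seq nat} | greedy_step (contact_edge c) v u y]
    [set c : {ffun 'I_n -> seq nat} | (k < greedy_time (contact_edge c) y v)%N]).
  by move=> z; rewrite !inE negbK.
by move=> z zy; rewrite inE; apply: contraL zy => /eqP ->; rewrite -ltnNge.
Qed.

(** First-step decomposition: exactly one [y] is the next node, and the remaining time is one
    less. *)
Lemma prob_late_eventS k u v : u != v ->
  P (late_event k.+1 u v) =
  (\sum_(y < n) P (step_event u v y) * P (late_event k y v))%E.
Proof.
move=> uv; rewrite (_ : late_event k.+1 u v =
    \bigcup_(y in [set` predT]) (step_event u v y `&` late_event k y v)).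
  rewrite measure_fin_pred; last 2 first.
  - move=> y; apply: measurableI; first exact: measurable_step_event.
    exact: measurable_late_event.
  - by move=> y z w [uy _] [uz _]; exact: step_event_uniq uy uz.
  by apply: eq_bigr => y _; exact: step_late_independent.
have timeS y w : step_event u v y w -> greedy_time (route_edge w) u v =
    (greedy_time (route_edge w) y v).+1.
  by rewrite /step_event /= random_edge_contact; exact: greedy_time_step.
apply/seteqP; split => w.
  move=> kw; have [y wy] := step_event_ex w uv.
  by exists y => //; split => //; move: kw; rewrite /late_event /= (timeS y).
by move=> [y _ [wy ky]]; rewrite /late_event /= (timeS y).
Qed.

End Routing.

(** * Halving the distance *)

Section Drift.
Context {R : realType} {d : measure_display} {Omega : measurableType d}.
Variables (n : nat) (P : probability Omega R).
Variables (D : 'I_n -> {RV P >-> nat}) (Delta : 'I_n -> nat -> {RV P >-> nat}).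
Implicit Types (u v y : 'I_n).

(** The number of binary digits of [r]. Doubling the argument gives 0 at [r = 0] and 1 at [r = 1],
    so that the last step, from distance 1 to 0, also counts as a halving. *)
Definition halvings (r : nat) : nat := trunc_log 2 r.*2.

Lemma leq_halvings r s : (r <= s)%N -> (halvings r <= halvings s)%N.
Proof. by move=> rs; apply: leq_trunc_log; rewrite leq_double. Qed.

Lemma halvings_lt r s : (0 < s)%N -> (r.*2 <= s)%N -> (halvings r < halvings s)%N.
Proof.
by move=> s0 rs; rewrite {2}/halvings trunc_log2_double// ltnS leq_trunc_log.
Qed.

Hypothesis indX : mutually_independent (ring_variables D Delta).
Variable q : R.
Hypothesis q0 : 0 < q.
Hypothesis halving_prob : forall u v, u != v ->
  q <= \sum_(y < n | ((ring_dist y v).*2 <= ring_dist u v)%N)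
         fine (P (step_event D Delta u v y)).

(** A potential argument: [halvings] of the distance, divided by [q], falls on average by at least 1
    per step, since it never rises and falls by at least [1 / q] with probability at least [q].
    Partial sums over [k < m] allow induction on [m]. *)
Lemma late_sum_le (m : nat) u v :
  \sum_(k < m) fine (P (late_event D Delta k u v)) <=
  (halvings (ring_dist u v))%:R / q.
Proof.
elim: m u => [|m IHm] u.
  by rewrite big_ord0 divr_ge0// ltW.
have [->|uv] := eqVneq u v.
  rewrite big1 ?divr_ge0// ?ltW// => k _.
  rewrite (_ : late_event _ _ _ _ _ = set0) ?measure0//.
  by apply/seteqP; split => // w; rewrite /late_event /= random_edge_contact
    greedy_time_refl.
pose s y := fine (P (step_event D Delta u v y)).
have s0 y : 0 <= s y by exact: fine_ge0.
have d0 : (0 < ring_dist u v)%N by rewrite lt0n ring_dist_eq0.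
have sum_s : \sum_(y < n) s y = 1.
  rewrite sum_fine => [|y _]; last by rewrite fin_num_measure//; exact: measurable_step_event.
  rewrite -(@measure_fin_pred _ _ _ P _ predT) => [|y|y z w]; last 2 first.
  - exact: measurable_step_event.
  - exact: step_event_uniq.
  suff -> : \bigcup_(y in [set` predT]) step_event D Delta u v y = setT.
    by rewrite [X in fine X](probability_setT P).
  apply/seteqP; split => // w _.
  by have [y wy] := step_event_ex D Delta w uv; exists y.
have lateS k : fine (P (late_event D Delta k.+1 u v)) =
    \sum_(y < n) s y * fine (P (late_event D Delta k y v)).
  rewrite (prob_late_eventS indX _ uv) -sum_fine => [|y _].
    apply: eq_bigr => y _; rewrite fineM// fin_num_measure//.
    - exact: measurable_step_event.
    - exact: measurable_late_event.
  rewrite fin_numM// fin_num_measure//.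
  - exact: measurable_step_event.
  - exact: measurable_late_event.
rewrite big_ord_recl /=.
have l0 : fine (P (late_event D Delta 0 u v)) <= 1.
  by rewrite -lee_fin fineK ?fin_num_measure ?probability_le1//; exact: measurable_late_event.
under eq_bigr do rewrite /bump /= add1n lateS.
rewrite exchange_big /=; under eq_bigr do rewrite -mulr_sumr.
(* Induction hypothesis at [y], weighted by the step probability: the potential of [u] bounds it,
   less [1 / q] when the distance is halved. *)
have step_le y : s y * (\sum_(k < m) fine (P (late_event D Delta k y v))) <=
    s y * ((halvings (ring_dist u v))%:R / q) -
    (if ((ring_dist y v).*2 <= ring_dist u v)%N then s y else 0) / q.
  have [yu|yu] := ltnP (ring_dist y v) (ring_dist u v); last first.
    have -> : s y = 0.
      rewrite /s (_ : step_event _ _ _ _ _ = set0) ?measure0//.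
      by apply/seteqP; split => // w /(step_event_lt uv); rewrite ltnNge yu.
    by rewrite if_same !mul0r subr0.
  apply: (le_trans (ler_wpM2l (s0 y) (IHm y))).
  case: ifPn => [yu2|_]; last first.
    by rewrite mul0r subr0 ler_wpM2l// ler_pM2r ?invr_gt0// ler_nat leq_halvings// ltnW.
  rewrite -mulrBr ler_wpM2l// -{3}[q^-1]mul1r -mulrBl ler_pM2r ?invr_gt0//.
  by rewrite lerBrDr natr1 ler_nat halvings_lt.
apply: le_trans (lerD l0 (ler_sum _ (fun y _ => step_le y))) _.
rewrite sumrB -mulr_suml sum_s mul1r -mulr_suml -big_mkcond/=.
(* The expected drop in potential is at least [q / q = 1], which pays for the present step. *)
have := halving_prob uv; rewrite -(ler_pM2r (x := q^-1)) ?invr_gt0// divff ?gt_eqF//.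
by rewrite addrCA gerDl subr_le0.
Qed.

End Drift.

(** * Bernoulli's inequality and the truncated mean *)

Section TruncatedMean.
Context {R : realFieldType}.

(** The induction step is [(1 - h)(1 + (k + 1)h) = 1 + kh - (k + 1)h^2 <= 1 + kh]. *)
Lemma bernoulli_inv (h : R) (k : nat) : 0 <= h <= 1 ->
  (1 - h) ^+ k * (1 + k%:R * h) <= 1.
Proof.
move=> /andP[h0 h1]; elim: k => [|k IHk]; first by rewrite mul0r addr0 mulr1.
apply: le_trans IHk; rewrite exprSr -mulrA ler_wpM2l ?exprn_ge0 ?subr_ge0//.
rewrite -natr1; have : 0 <= (k%:R : R) by [].
nra.
Qed.

(* If X has law w and M <= c / h, then E[(1-h)^min(X,M)] <= 1 - h/(1+c) E[min(X,M)],
   and E[min(X,M)] dominates E[X | X <= M] since the latter is at most M. *)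
Lemma truncated_mean_le (w : nat -> R) (M : nat) (h c : R) :
    (forall k, 0 <= w k) -> 0 < \sum_(k < M.+1) w k <= 1 ->
    0 <= h <= 1 -> M%:R * h <= c ->
  \sum_(k < M.+1) w k * (1 - h) ^+ k + (1 - \sum_(k < M.+1) w k) * (1 - h) ^+ M <=
  1 - h / (1 + c) * ((\sum_(k < M.+1) k%:R * w k) / \sum_(k < M.+1) w k).
Proof.
set a := \sum_(k < M.+1) w k; set S := \sum_(k < M.+1) k%:R * w k.
move=> w0 /andP[a0 a1] h01 Mh; have /andP[h0 h1] := h01.
have c0 : 0 <= c by apply: le_trans Mh; rewrite mulr_ge0.
have c1 : 0 < 1 + c by rewrite ltr_pwDl.
set b := h / (1 + c); have b0 : 0 <= b by rewrite divr_ge0// ltW.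
(* As long as [k h <= c], the bound [1 / (1 + k h)] lies below this line, by the identity
   [(1 - b k)(1 + k h) = 1 + b k (c - k h)]. *)
have powle k : (k <= M)%N -> (1 - h) ^+ k <= 1 - b * k%:R.
  move=> kM; have kh : k%:R * h <= c.
    by apply: le_trans Mh; rewrite ler_wpM2r// ler_nat.
  have k1 : 0 < 1 + k%:R * h by rewrite ltr_pwDl// mulr_ge0.
  rewrite -(ler_pM2r k1); apply: le_trans (bernoulli_inv k h01) _.
  have -> : (1 - b * k%:R) * (1 + k%:R * h) =
      1 + b * k%:R * (c - k%:R * h).
    by rewrite /b; field; rewrite gt_eqF.
  by rewrite lerDl; apply: mulr_ge0; [exact: mulr_ge0|rewrite subr_ge0].
have le1 : \sum_(k < M.+1) w k * (1 - h) ^+ k <= a - b * S.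
  rewrite /a /S mulr_sumr -sumrB; apply: ler_sum => k _.
  have -> : w k - b * (k%:R * w k) = w k * (1 - b * k%:R) by ring.
  by rewrite ler_wpM2l// powle// -ltnS.
have le2 : (1 - a) * (1 - h) ^+ M <= (1 - a) * (1 - b * M%:R).
  by rewrite ler_wpM2l ?subr_ge0// powle.
have SM : S <= a * M%:R.
  rewrite /S /a mulr_suml; apply: ler_sum => k _.
  by rewrite mulrC ler_wpM2l// ler_nat -ltnS.
have SaM : S / a <= M%:R by rewrite ler_pdivrMr// mulrC.
apply: le_trans (lerD le1 le2) _.
have -> : a - b * S + (1 - a) * (1 - b * M%:R) = 1 - b * (S + (1 - a) * M%:R) by ring.
rewrite lerD2l lerN2 ler_wpM2l//.
(* Replacing the last [S / a] by its upper bound [M] turns the right side into the mean of min(X,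
   M). *)
have {1}-> : S / a = S + (1 - a) * (S / a) by field; rewrite gt_eqF.
by rewrite lerD2l ler_wpM2l ?subr_ge0.
Qed.

End TruncatedMean.

(** * The probability that one step halves the distance *)

Section HalvingContact.
Context {R : realType} {d : measure_display} {Omega : measurableType d}.
Variables (n : nat) (P : probability Omega R).
Variables (D : 'I_n -> {RV P >-> nat}) (Delta : 'I_n -> nat -> {RV P >-> nat}).
Variable p : probability nat R.
Hypothesis n2 : (2 <= n)%N.
Hypothesis ring_law : harmonic_ring D Delta p.
Implicit Types (u v y : 'I_n) (r : nat).

Local Notation X := (ring_variables D Delta).
Local Notation H := (\sum_(1 <= i < n) i%:R^-1 : R).

(** The offsets from [r / 2] rounded up to [r]: they do not overshoot and leave at most half of the
    distance [r]. *)
Definition halves r : pred nat := fun i => (i < r.+1)%N && (uphalf r <= i)%N.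

Lemma harmonic_ge1 : 1 <= H.
Proof.
rewrite big_ltn// invr1 lerDl; apply: sumr_ge0 => i _.
by rewrite invr_ge0.
Qed.

(** At least [r / 2] offsets halve the distance, and each has probability at least [1 / (H r)]. *)
Lemma prob_offset_halves u j r : (0 < r < n)%N ->
  (2 * H)^-1 <= fine (P [set w | halves r (Delta u j w)]).
Proof.
move=> /andP[r0 rn]; have H0 : 0 < H by apply: lt_le_trans harmonic_ge1.
have -> : [set w | halves r (Delta u j w)] =
    \bigcup_(i in [set` (fun i : 'I_n => halves r i)]) [set w | Delta u j w = i].
  apply/seteqP; split => w /=; last by move=> [i /= hi ->].
  move=> hw; have /andP[_ wn] := lrc_offset_range ring_law u j w.
  have wn' : (Delta u j w < n)%N by rewrite (leq_ltn_trans wn)// ltn_predL; lia.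
  by exists (Ordinal wn').
rewrite measure_fin_pred; last 2 first.
- by move=> i; exact: (measurable_variable D Delta (inr (u, j)) [set val i]).
- by move=> i i' w /= -> /ord_inj.
rewrite -sum_fine => [|i _]; last first.
  by rewrite fin_num_measure//; exact: (measurable_variable D Delta (inr (u, j)) [set val i]).
apply: (@le_trans _ _ (\sum_(i < n | halves r i) (H * r%:R)^-1)).
  rewrite -(big_mkord (halves r) (fun=> (H * r%:R)^-1)).
  have -> : \sum_(0 <= i < n | halves r i) (H * r%:R)^-1 =
      \sum_(uphalf r <= i < r.+1) (H * r%:R)^-1.
    by rewrite (big_nat_widen _ r.+1 n)// (big_nat_widenl (uphalf r) 0).
  rewrite sumr_const_nat -[leRHS]mulr_natr !invfM [leLHS]mulrC -[leRHS]mulrA.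
  rewrite ler_pM2l ?invr_gt0//.
  rewrite ler_pdivlMl ?ltr0n// ler_pdivrMr// -natrM ler_nat.
  by lia.
apply: ler_sum => i /andP[ir ri].
have i0 : (0 < i)%N by lia.
rewrite [X in fine X](lrc_offset_law ring_law); last by have := ltn_ord i; lia.
by rewrite [leRHS]/= lef_pV2 ?posrE ?mulr_gt0 ?ltr0n// ler_pM2l// ler_nat.
Qed.

(** The number [m] of inspected offsets is fixed and not tied to [D u], so the event is an
    intersection of conditions on [m + 1] independent variables. *)
Definition missed_event u r (A : set nat) (m : nat) : set Omega :=
  [set w | A (D u w) /\ forall j, (j < m)%N -> ~~ halves r (Delta u j w)].

Lemma missed_event_variables u r (A : set nat) (m : nat) :
  missed_event u r A m =
  [set w | forall i, i \in inl u :: [seq inr (u, j) | j <- iota 0 m] ->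
    (if i is inl _ then A else [set k | ~~ halves r k]) (X i w)].
Proof.
apply/seteqP; split => w /=.
  move=> [Aw hw] i; rewrite inE => /orP[/eqP ->//|/mapP[j]].
  by rewrite mem_iota => /andP[_ jm] ->; exact: hw.
move=> h; split; first by apply: (h (inl u)); rewrite inE eqxx.
move=> j jm; apply: (h (inr (u, j))); rewrite inE /=.
by apply: map_f; rewrite mem_iota.
Qed.

Lemma measurable_missed_event u r A m : measurable (missed_event u r A m).
Proof.
rewrite missed_event_variables.
exact: (@measurable_variables _ _ _ _ _ D Delta
  (fun i => if i is inl _ then A else [set k | ~~ halves r k])).
Qed.

Lemma prob_missed_le u r (A : set nat) (m : nat) : (0 < r < n)%N ->
  fine (P (missed_event u r A m)) <=
  fine (P [set w | A (D u w)]) * (1 - (2 * H)^-1) ^+ m.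
Proof.
move=> rn; rewrite missed_event_variables.
pose B (i : 'I_n + 'I_n * nat) : set nat :=
  if i is inl _ then A else [set k | ~~ halves r k].
have mB i : measurable [set w | B i (X i w)] by exact: measurable_variable.
rewrite (@mutually_independent_seq _ _ _ _ _ _ _ X B)//; last 2 first.
- exact: lrc_independent ring_law.
- rewrite /= map_inj_uniq ?iota_uniq ?andbT; last by move=> i j [].
  by apply/mapP => -[].
rewrite big_cons fineM ?fin_num_measure//; last first.
  by apply: prode_fin_num => i _; rewrite fin_num_measure.
rewrite ler_wpM2l ?fine_ge0//.
rewrite big_map; elim: m => [|m IHm]; first by rewrite big_nil expr0.
rewrite -addn1 iotaD big_cat big_seq1 addn1 exprSr fineM ?fin_num_measure//; last first.
  by apply: prode_fin_num => i _; rewrite fin_num_measure.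
apply: ler_pM => //; rewrite ?fine_ge0//.
  by apply: prode_ge0.
rewrite -lee_fin fineK ?fin_num_measure//.
have := prob_offset_halves u m rn.
set E := [set w | halves r _]; have mE : measurable E.
  exact: (measurable_variable D Delta (inr (u, m)) [set k | halves r k]).
rewrite (_ : [set w | _] = ~` E); last first.
  by apply/seteqP; split => w /= /negP.
rewrite probability_setC// => hE.
by rewrite -(@fineK _ (P E)) ?fin_num_measure// -EFinB lee_fin lerD2l lerN2.
Qed.

(** The complementary event, that no contact of [u] halves the distance, is split according to the
    number of contacts, with all numbers above [M] lumped together. The truncated mean bounds the
    resulting sum. *)
Lemma prob_halving_ge u v (M : nat) (c : R) : u != v ->
    0 < \sum_(k < M.+1) fine (p [set nat_of_ord k]) -> M%:R * (2 * H)^-1 <= c ->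
  (2 * H)^-1 / (1 + c) * ((\sum_(k < M.+1) k%:R * fine (p [set nat_of_ord k])) /
    \sum_(k < M.+1) fine (p [set nat_of_ord k])) <=
  \sum_(y < n | ((ring_dist y v).*2 <= ring_dist u v)%N)
    fine (P (step_event D Delta u v y)).
Proof.
move=> uv; set r := ring_dist u v => a0 Mc.
have H1 := harmonic_ge1.
have rn : (0 < r < n)%N by rewrite lt0n ring_dist_eq0 uv ring_dist_lt.
pose G := [set w | has (halves r) (contacts D Delta w u)].
have mG : measurable G.
  rewrite (_ : G = [set w | has (halves r) (config D Delta [set u]%SET w u)]).
    exact: (@measurable_config _ _ _ _ _ D Delta [set u]%SET
      [set c : {ffun 'I_n -> seq nat} | has (halves r) (c u)]).
  by apply/funext => w; rewrite /G /= ffunE finset.inE eqxx.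
(* One halving contact suffices, since the greedy step does at least as well. *)
have GP : G `<=` \bigcup_(y in [set` (fun y => ((ring_dist y v).*2 <= r)%N)])
    step_event D Delta u v y.
  move=> w /hasP[i iw /andP[ir ri]]; have [y uy] := step_event_ex D Delta w uv.
  exists y => //=; move: uy; rewrite /step_event /= random_edge_contact => uy.
  by have := greedy_step_contact iw _ uy; rewrite -/r => /(_ ir); lia.
have mstep y : measurable (step_event D Delta u v y) by exact: measurable_step_event.
apply: (@le_trans _ _ (fine (P G))); last first.
  rewrite sum_fine => [|y _]; last by rewrite fin_num_measure.
  rewrite -(@measure_fin_pred _ _ _ P _ (fun y => ((ring_dist y v).*2 <= r)%N))//.
    apply: fine_le; rewrite ?fin_num_measure//.
      by apply: fin_bigcup_measurable => //; exact: finite_finset.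
    by apply: le_measure => //; rewrite inE//; apply: fin_bigcup_measurable => //;
      exact: finite_finset.
  by move=> y z w; exact: step_event_uniq.
pose E (k : 'I_M.+1) := missed_event u r [set nat_of_ord k] k.
(* With more than [M] contacts only the first [M] are inspected; this can only enlarge the event of
   missing. *)
pose E' := missed_event u r [set k | (M < k)%N] M.
have mE k : measurable (E k) by exact: measurable_missed_event.
have mE' : measurable E' by exact: measurable_missed_event.
have mUE : measurable (\bigcup_(k in [set` predT]) E k).
  by apply: fin_bigcup_measurable => //; exact: finite_finset.
have GE : ~` G `<=` (\bigcup_(k in [set` predT]) E k) `|` E'.
  move=> w /= /negP; rewrite -all_predC => /allP miss.
  have {}miss j : (j < D u w)%N -> ~~ halves r (Delta u j w).
    by move=> jD; apply: miss; apply: map_f; rewrite mem_iota.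
  have [DM|DM] := leqP (D u w) M; last first.
    by right; split => // j jM; apply: miss; exact: ltn_trans DM.
  by left; exists (Ordinal (DM : (D u w < M.+1)%N)).
have pE k : fine (P (E k)) <= fine (p [set nat_of_ord k]) * (1 - (2 * H)^-1) ^+ k.
  by apply: le_trans (prob_missed_le u [set nat_of_ord k] k rn) _;
    rewrite (lrc_number_law ring_law).
have pD : fine (P [set w | (M < D u w)%N]) = 1 - \sum_(k < M.+1) fine (p [set nat_of_ord k]).
  have mD k : measurable [set w | D u w = k].
    exact: (measurable_variable D Delta (inl u) [set k]).
  have mDM : measurable
      (\bigcup_(k in [set` (predT : pred 'I_M.+1)]) [set w | D u w = k]).
    by apply: fin_bigcup_measurable => //; exact: finite_finset.
  rewrite (_ : [set w | _] =
    ~` \bigcup_(k in [set` (predT : pred 'I_M.+1)]) [set w | D u w = k]); last first.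
    apply/seteqP; split => w /=.
      by move=> MD [k _ /= Dk]; have := ltn_ord k; rewrite -Dk ltnS leqNgt MD.
    by move=> h; rewrite ltnNge; apply/negP => DM; apply: h;
      exists (Ordinal (DM : (D u w < M.+1)%N)).
  rewrite probability_setC// fineB ?fin_num_measure//.
  congr (1 - _); rewrite measure_fin_pred//; last by move=> k k' w /= -> /ord_inj.
  rewrite -sum_fine => [|k _]; last by rewrite fin_num_measure.
  by apply: eq_bigr => k _; congr fine; exact: (lrc_number_law ring_law).
have pE' : fine (P E') <=
    (1 - \sum_(k < M.+1) fine (p [set nat_of_ord k])) * (1 - (2 * H)^-1) ^+ M.
  by rewrite -pD; exact: (prob_missed_le u [set k | (M < k)%N] M rn).
have a1 : \sum_(k < M.+1) fine (p [set nat_of_ord k]) <= 1.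
  by rewrite -subr_ge0 -pD fine_ge0.
have h01 : 0 <= (2 * H)^-1 <= 1.
  rewrite invr_ge0 mulr_ge0//= ?(le_trans ler01)// invf_le1; first by lra.
  by rewrite mulr_gt0// (lt_le_trans ltr01).
have := @truncated_mean_le _ (fun k => fine (p [set k])) M _ _
  (fun k => fine_ge0 (measure_ge0 _ _)) _ h01 Mc.
rewrite a0 a1 => /(_ erefl) le1.
have PG : fine (P (~` G)) = 1 - fine (P G).
  by rewrite probability_setC// fineB ?fin_num_measure.
suff : fine (P (~` G)) <= \sum_(k < M.+1) fine (P (E k)) + fine (P E').
  have sumE := ler_sum (index_enum _) (fun k (_ : true) => pE k).
  by rewrite PG => /le_trans/(_ (lerD sumE pE'))/le_trans/(_ le1); rewrite lerD2l lerN2.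
rewrite sum_fine => [|k _]; last by rewrite fin_num_measure.
rewrite -(@measure_fin_pred _ _ _ P _ predT)//; last first.
  by move=> k k' w [/= Dk _] [/= Dk' _]; apply: ord_inj; rewrite -Dk.
rewrite -fineD ?fin_num_measure//; apply: fine_le; rewrite ?fin_num_measure//.
- exact: measurableC.
- by rewrite fin_numD !fin_num_measure.
apply: (@le_trans _ _ (P ((\bigcup_(k in [set` predT]) E k) `|` E'))).
  by apply: le_measure => //; rewrite inE; [exact: measurableC|exact: measurableU].
exact: measureU2.
Qed.

End HalvingContact.

(** * Asymptotics *)

Section Estimates.
Context {R : realType}.

(** For integers, [X <= t] means [X <= M], so the conditional expectation is a ratio of finite sums
    over the law. *)
Lemma cond_expectation_truncn {d : measure_display} {T : measurableType d}
    (Q : probability T R) (X : {RV Q >-> nat}) (w : nat -> R) (t : R) :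
    (forall k, fine (Q [set x | X x = k]) = w k) -> 0 <= t ->
    (0 < Q [set x | ((X x)%:R <= t)%R])%E ->
  let M := Num.truncn t in
  0 < \sum_(k < M.+1) w k /\
  cond_expectation Q (fun x => (X x)%:R) [set x | (X x)%:R <= t] =
  ((\sum_(k < M.+1) k%:R * w k) / \sum_(k < M.+1) w k)%:E.
Proof.
move=> Xw t0 QA M.
set A := [set x | _] in QA *.
have AM x : A x <-> (X x <= M)%N by rewrite /A /= truncn_ge_nat.
have mX k : measurable [set x | X x = k].
  by rewrite -[[set _ | _]]setTI; exact: (measurable_funPT X measurableT [set k]).
have AE : A = \bigcup_(k in [set` (predT : pred 'I_M.+1)]) [set x | X x = k].
  apply/seteqP; split => x.
    by move=> /AM XM; exists (Ordinal (XM : (X x < M.+1)%N)).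
  by move=> [k _ /= Xk]; apply/AM; rewrite Xk -ltnS.
have mA : measurable A.
  by rewrite AE; apply: fin_bigcup_measurable => //; exact: finite_finset.
have QAE : Q A = (\sum_(k < M.+1) w k)%:E.
  rewrite AE measure_fin_pred//; last by move=> k k' x /= -> /ord_inj.
  by rewrite -sumEFin; apply: eq_bigr => k _; rewrite -Xw fineK ?fin_num_measure.
have a0 : 0 < \sum_(k < M.+1) w k by rewrite -lte_fin -QAE.
split=> //; rewrite /cond_expectation QAE.
have -> : (\int[Q]_(x in A) ((X x)%:R)%:E)%E = (\sum_(k < M.+1) k%:R * w k)%:E.
  transitivity (\int[Q]_(x in A)
      (\sum_(k < M.+1) (k%:R%:E * (\1_[set x | X x = k] x : R)%:E)))%E.
    apply: eq_integral => x /set_mem/AM XM.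
    rewrite (bigD1 (Ordinal (XM : (X x < M.+1)%N)))//= big1 => [|k kX].
      by rewrite indicE mem_set// mule1 adde0.
    by rewrite indicE memNset ?mule0//= => Xk; move/eqP: kX; apply; exact: ord_inj.
  rewrite ge0_integral_sum//; last first.
    move=> k; apply: measurable_funeM; apply/measurable_EFinP.
    exact: measurable_indic.
  rewrite -sumEFin; apply: eq_bigr => k _.
  rewrite ge0_integralZl//; last by apply/measurable_EFinP; exact: measurable_indic.
  rewrite integral_indic// setIidl; last by move=> x /= Xk; apply/AM; rewrite Xk -ltnS.
  by rewrite EFinM -Xw fineK ?fin_num_measure.
by rewrite inver gt_eqF// -EFinM.
Qed.

(** Induction with [ln (1 + 1/n) <= 1/n]. *)
Lemma ln_le_harmonic (n : nat) : (0 < n)%N ->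
  ln (n%:R : R) <= \sum_(1 <= i < n) i%:R^-1.
Proof.
elim: n => // -[_ _|n IHn _]; first by rewrite big_nil ln1.
rewrite big_nat_recr//=.
apply: (@le_trans _ _ (ln n.+1%:R + n.+1%:R^-1)); last by rewrite lerD2r IHn.
have n0 : (0 : R) < n.+1%:R by rewrite ltr0n.
rewrite -lerBlDl -ln_div ?posrE ?ltr0n//.
rewrite -[n.+2%:R]natr1 mulrDl divff ?gt_eqF// mul1r.
by apply: le_ln1Dx; rewrite (lt_trans (ltrN10 _)) ?invr_gt0.
Qed.

(** Induction on the sharper bound [1 + ln (n - 1)] for [n >= 2], with [ln (1 - 1/m) <= - 1/m]. *)
Lemma harmonic_le_ln (n : nat) : (0 < n)%N ->
  \sum_(1 <= i < n) i%:R^-1 <= 1 + ln (n%:R : R).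
Proof.
case: n => [|[|n]] // _; first by rewrite big_nil addr_ge0// ln_ge0.
apply: (@le_trans _ _ (1 + ln (n.+1%:R : R))); last first.
  by rewrite lerD2l ler_ln ?posrE ?ltr0n// ler_nat.
elim: n => [|n IHn]; first by rewrite big_nat1 invr1 lerDl ln_ge0.
rewrite big_nat_recr//=.
apply: le_trans (lerD IHn (lexx _)) _; rewrite -addrA lerD2l /=.
have n1 : (0 : R) < n.+1%:R by rewrite ltr0n.
have n2 : (0 : R) < n.+2%:R by rewrite ltr0n.
have : ln (n.+1%:R / n.+2%:R : R) <= - n.+2%:R^-1.
  have -> : n.+1%:R / n.+2%:R = 1 + - n.+2%:R^-1 :> R.
    by rewrite -[n.+1%:R](addrK 1) natr1 mulrBl divff ?gt_eqF// mul1r.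
  by apply: le_ln1Dx; rewrite ltrN2 invf_lt1// ltr1n.
rewrite ln_div ?posrE//.
by move: (ln n.+1%:R : R) (ln n.+2%:R : R) (n.+2%:R^-1 : R) => x y z; lra.
Qed.

Lemma halvings_le_ln (r n : nat) : (r <= n)%N -> (0 < n)%N ->
  (halvings r)%:R <= 1 + ln (n%:R : R) / ln 2.
Proof.
move=> rn n0; apply: le_trans (_ : (halvings n)%:R <= _).
  by rewrite ler_nat leq_halvings.
have ln2 : 0 < ln (2 : R) by rewrite ln_gt0// ltr1n.
rewrite -(ler_pM2r ln2) mulrDl mul1r divfK ?gt_eqF//.
rewrite mulr_natl -lnXn// -lnM ?posrE ?ltr0n// ler_ln ?posrE ?mulr_gt0 ?exprn_gt0 ?ltr0n//.
by rewrite -natrX -natrM ler_nat mul2n; apply: trunc_logP => //; rewrite double_gt0.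
Qed.

End Estimates.

(** * Averaging over the distances and choice of the constant *)

Lemma average_greedy_time_le {R : realType} {d : measure_display}
    {Omega : measurableType d} (n : nat) (P : probability Omega R)
    (D : 'I_n -> {RV P >-> nat}) (Delta : 'I_n -> nat -> {RV P >-> nat}) (B : R) :
    (0 < n)%N -> 0 <= B -> (forall u v, (expected_greedy_time D Delta u v <= B%:E)%E) ->
  (average_greedy_time D Delta <= B%:E)%E.
Proof.
move=> n0 B0 hB; rewrite /average_greedy_time.
have TB r : (expected_time_at D Delta r <= B%:E)%E.
  (* The default value of [xget] is 0, which [0 <= B] covers. *)
  rewrite /expected_time_at; case: xgetP => [_ _ [u [v [_ ->]]]|_]; first exact: hB.
  by rewrite lee_fin.
apply: (@le_trans _ _ ((n%:R^-1)%:E * \sum_(0 <= r < n) B%:E)%E).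
  by rewrite lee_wpmul2l// ?lee_fin ?invr_ge0//; apply: lee_sum.
rewrite sumEFin -EFinM lee_fin sumr_const_nat subn0 -[B *+ n]mulr_natl mulKf//.
by rewrite pnatr_eq0 -lt0n.
Qed.

Theorem theorem1 (R : realType)
    (p : nat -> probability nat R)
    (d : nat -> measure_display) (Omega : forall n, measurableType (d n))
    (P : forall n, probability (Omega n) R)
    (D : forall n, 'I_n -> {RV P n >-> nat})
    (Delta : forall n, 'I_n -> nat -> {RV P n >-> nat})
    (hring : forall n, (2 <= n)%N -> harmonic_ring (@D n) (@Delta n) (p n))
    (d' : nat -> measure_display) (Omega' : forall n, measurableType (d' n))
    (Q : forall n, probability (Omega' n) R)
    (X : forall n, {RV Q n >-> nat})
    (hX : forall n k, (2 <= n)%N -> Q n [set w | X n w = k] = p n [set k])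
    (c : R) (c0 : 0 < c)
    (hpos : forall n, (2 <= n)%N ->
      (0 < Q n [set w | ((X n w)%:R <= c * ln n%:R)%R])%E) :
  exists2 C : R, 0 < C & \forall n \near \oo,
    (average_greedy_time (@D n) (@Delta n) <=
     C%:E * ((ln n%:R ^+ 2)%:E /
       cond_expectation (Q n) (fun w => (X n w)%:R%R)
         [set w | ((X n w)%:R <= c * ln n%:R)%R]))%E.
Proof.
have ln20 : 0 < ln (2 : R) by rewrite ln_gt0// ltr1n.
have c20 : 0 < 1 + c / 2 by rewrite ltr_pwDl// divr_ge0// ltW.
have l20 : 0 < 1 + (ln (2 : R))^-1 by rewrite ltr_pwDl// invr_ge0 ltW.
(* With [L = ln n], the bound is [(1 + L / ln 2) * 2H (1 + c / 2) / mu]. The constant absorbs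
   [1 + L / ln 2 <= L (1 + 1 / ln 2)] and [2H <= 4L]. *)
exists (4 * (1 + c / 2) * (1 + (ln 2)^-1)); first by rewrite !mulr_gt0.
near=> n.
have n2 : (2 <= n)%N by near: n; exact: nbhs_infty_ge.
have n0 : (0 < n)%N by lia.
have L1 : 1 <= ln (n%:R : R).
  rewrite -[leLHS]expRK ler_ln ?posrE ?expR_gt0 ?ltr0n//.
  by near: n; exact: nbhs_infty_ger.
set L := ln (n%:R : R) in L1 *; have L0 : 0 < L by exact: lt_le_trans L1.
have t0 : 0 <= c * L by rewrite mulr_ge0 ?ltW.
have [] := cond_expectation_truncn (w := fun k => fine (p n [set k]))
  (fun k => congr1 fine (hX n k n2)) t0 (hpos n n2).
set M := Num.truncn _ => /= a0 ->.
set mu := _ / \sum_(k < M.+1) _.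
have mu0 : 0 <= mu.
  apply: divr_ge0; last exact: ltW.
  by apply: sumr_ge0 => k _; rewrite mulr_ge0 ?fine_ge0.
(* If the conditional expectation vanishes, the right-hand side is [+oo]. *)
move: mu0; rewrite le_eqVlt => /predU1P[<-|mu0].
  rewrite inve0 gt0_muley ?lte_fin ?exprn_gt0//.
  by rewrite gt0_muley ?leey// lte_fin !mulr_gt0.
set H := \sum_(1 <= i < n) i%:R^-1 : R.
have LH : L <= H by exact: ln_le_harmonic.
have HL : H <= 2 * L.
  by apply: le_trans (@harmonic_le_ln R n n0) _; rewrite mulr_natl mulr2n lerD2r.
have H0 : 0 < H by exact: lt_le_trans LH.
(* From [M <= c L <= c H]; hence the truncation lemma is applied with [c / 2] in place of [c]. *)
have Mh : M%:R * (2 * H)^-1 <= c / 2.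
  rewrite ler_pdivrMr ?mulr_gt0// mulrA divfK//.
  apply: (@le_trans _ _ (c * L)); first by rewrite truncn_le.
  by rewrite ler_pM2l.
set q := (2 * H)^-1 / (1 + c / 2) * mu.
have q0 : 0 < q by rewrite mulr_gt0// divr_gt0// invr_gt0 mulr_gt0.
have halving u v : u != v -> q <=
    \sum_(y < n | ((ring_dist y v).*2 <= ring_dist u v)%N)
      fine (P n (step_event (@D n) (@Delta n) u v y)).
  by move=> uv; exact: (prob_halving_ge n2 (hring _ n2) uv a0 Mh).
have B0 : 0 <= (1 + L / ln 2) / q.
  by apply: divr_ge0; [rewrite addr_ge0// divr_ge0// ltW|exact: ltW].
apply: le_trans (average_greedy_time_le n0 B0 _) _.
  move=> u v; rewrite expected_greedy_time_late.
  rewrite -EFin_sum_fine => [|k _]; last first.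
    by rewrite fin_num_measure//; exact: measurable_late_event.
  rewrite lee_fin.
  apply: le_trans (late_sum_le (lrc_independent (hring _ n2)) q0 halving n u v) _.
  rewrite ler_pM2r ?invr_gt0// halvings_le_ln//.
  exact/ltnW/ring_dist_lt.
rewrite inver gt_eqF// -!EFinM lee_fin.
have -> : (1 + L / ln 2) / q = (1 + L / ln 2) * (2 * H) * (1 + c / 2) / mu.
  by rewrite /q [in LHS]invfM [in LHS]invf_div invrK !mulrA; ring.
rewrite [leRHS]mulrA ler_pM2r ?invr_gt0//.
have -> : 4 * (1 + c / 2) * (1 + (ln 2)^-1) * L ^+ 2 =
    (L * (1 + (ln 2)^-1)) * (2 * (2 * L)) * (1 + c / 2) by ring.
rewrite ler_pM2r//; apply: ler_pM.
- by rewrite addr_ge0// divr_ge0// ltW.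
- by rewrite mulr_ge0// ltW.
- by rewrite mulrDr mulr1 lerD2r.
- by rewrite ler_pM2l.
Unshelve. all: by end_near.
Qed.
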